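(* Let ${\tt G}$ be a digraph. Then there is a decomposition of ${\tt G}$ into dynamical modules ${\tt M}_1,\dots,{\tt M}_k$ of ${\tt G}$ (i.e. each ${\tt M}_i$ is a dynamical module of ${\tt G}$ and the edge sets $E({\tt M}_1),\dots,E({\tt M}_k)$ partition $E({\tt G})$), this decomposition is unique up to re-ordering, and there is a homotopy equivalence \[X({\tt G})\simeq X({\tt M}_1)\ast\cdots\ast X({\tt M}_k),\] where $\ast$ denotes the join of simplicial complexes. Furthermore, this decomposition can be found algorithmically.
   Context: A digraph ${\tt G}$ consists of a finite vertex set $V({\tt G})$ and a set $E({\tt G})$ of ordered pairs $(u,v)$ of distinct vertices (edges); for $e=(u,v)$, $s(e)=u$ is its source and $t(e)=v$ its target. A simple path is a sequence of edges $e_1,\dots,e_r$ ($r\ge1$) with $s(e_{i+1})=t(e_i)$, in which no vertex is encountered twice and $s(e_1)\neq t(e_r)$. A multipath of ${\tt G}$ is a spanning subgraph each of whose connected components is either a single vertex or a simple path (equivalently, a set of edges in which every vertex has in-degree and out-degree at most $1$ and which contains no oriented cycle). The multipath complex $X({\tt G})$ is the simplicial complex with vertex set $E({\tt G})$ whose simplices are the nonempty edge sets of multipaths of ${\tt G}$. A vertex $v$ is stable in a digraph ${\tt H}$ if its in-degree or its out-degree in ${\tt H}$ is zero, and unstable otherwise. For a subgraph ${\tt R}\le{\tt G}$, the complement $C_{{\tt G}}({\tt R})$ is the subgraph of ${\tt G}$ spanned by the edges in $E({\tt G})\setminus E({\tt R})$ (its vertices are the endpoints of these edges), and the boundary is $\partial_{{\tt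 G}}{\tt R}=V({\tt R})\cap V(C_{{\tt G}}({\tt R}))$. A dynamical region of ${\tt G}$ is a connected full (induced) subgraph ${\tt R}\le{\tt G}$ with at least one edge such that (a) every vertex of $\partial_{{\tt G}}{\tt R}$ is unstable in ${\tt G}$ but stable in both ${\tt R}$ and $C_{{\tt G}}({\tt R})$; (b) no edge of ${\tt R}$ belongs to an oriented cycle of ${\tt G}$ which is not contained in ${\tt R}$. A dynamical module of ${\tt G}$ is a minimal (with respect to inclusion) dynamical region of ${\tt G}$.
   Formalization: Dynamical regions (hence modules) are not required to be full (induced) subgraphs; with that requirement a decomposition need not exist, e.g. for the digraph with edges x→a, x→y, z→y, z→w, b→w, a→b. *)

(* Defs.v *)
From HB Require Import structures.
From mathcomp Require Import all_boot all_order all_algebra.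
From mathcomp Require Import all_classical all_reals all_analysis.
From mathcomp Require Import fintype finset.

Set Implicit Arguments.
Unset Strict Implicit.
Unset Printing Implicit Defensive.

Import Order.TTheory GRing.Theory Num.Theory.
Import numFieldNormedType.Exports.

(** * Digraphs *)

(* A digraph and its subgraphs live in a common finite type T, each with its
   own vertex set.  The pair is (vertices, edges). *)
Definition digraph_axiom (T : finType) (p : {set T} * {set T * T}) : bool :=
  [forall e in p.2, [&& e.1 \in p.1, e.2 \in p.1 & e.1 != e.2]].

Record digraph (T : finType) := Digraph {
  digraph_val : {set T} * {set T * T};
  digraphP : digraph_axiom digraph_val
}.

HB.instance Definition _ (T : finType) := [isSub for @digraph_val T].
HB.instance Definition _ (T : finType) := [Equality of digraph T by <:].

Section Digraphs.
Context {T : finType}.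
Implicit Types (G H R P : digraph T) (v : T) (c : seq T) (p : seq (T * T)).

Definition verts G : {set T} := (digraph_val G).1.
Definition edges G : {set T * T} := (digraph_val G).2.

Lemma edgeP G e : e \in edges G ->
  [/\ e.1 \in verts G, e.2 \in verts G & e.1 != e.2].
Proof. by move=> Ge; move/forall_inP: (digraphP G) => /(_ e Ge)/and3P. Qed.

Definition subdigraph H G : bool :=
  (verts H \subset verts G) && (edges H \subset edges G).

Definition indeg H v : nat := #|[set e in edges H | e.2 == v]|.
Definition outdeg H v : nat := #|[set e in edges H | e.1 == v]|.

Definition stable H v : bool := (indeg H v == 0) || (outdeg H v == 0).
Definition unstable H v : bool := ~~ stable H v.

Definition adj H : rel T := fun u v => ((u, v) \in edges H) || ((v, u) \in edges H).
Definition connected_digraph H : Prop := {in verts H &, forall u v, connect (adj H) u v}.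

Definition edge_rel H : rel T := fun u v => (u, v) \in edges H.

(* Oriented cycles are given by their sequences of (distinct) vertices; as
   digraphs have no loops, such a cycle has at least two edges. *)
Definition oriented_cycle H c : bool := (c != [::]) && ucycleb (edge_rel H) c.
Definition cycle_edges c : {set T * T} := [set (v, next c v) | v in c].

(** * Multipaths *)

Definition path_verts p : seq T :=
  if p is e :: _ then e.1 :: [seq f.2 | f <- p] else [::].

Definition simple_path H p : bool :=
  if p is e :: q then
    [&& all (mem (edges H)) p, path (fun f g => f.2 == g.1) e q
      & uniq (path_verts p)]
  else false.

Definition comp_verts H v : {set T} := [set w | connect (adj H) v w].
Definition comp_edges H v : {set T * T} := [set e in edges H | e.1 \in comp_verts H v].

Definition multipath G P : Prop :=
  [/\ subdigraph P G, verts P = verts G &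
      forall v, v \in verts P ->
        comp_verts P v = [set v] \/
        exists p, [/\ simple_path P p, comp_verts P v = [set x in path_verts p]
                    & comp_edges P v = [set e in p]]].

End Digraphs.

Section MultipathTheory.
Context {T : finType}.
Implicit Types (G P : digraph T) (p : seq (T * T)).

Lemma adj_sym P : symmetric (adj P).
Proof. by move=> u v; rewrite /adj orbC. Qed.

Lemma connect_adjC P : connect_sym (adj P).
Proof. by apply: sym_connect_sym; exact: adj_sym. Qed.

Lemma edge_connect P e : e \in edges P -> connect (adj P) e.1 e.2.
Proof. by case: e => u v Puv; apply: connect1; rewrite /adj Puv. Qed.

Lemma simple_path_nth P p : simple_path P p -> exists e0 v0 s, uniq s /\
  {in p, forall e, exists i, [/\ i.+1 < size s, e = nth e0 p i,
                                e.1 = nth v0 s i & e.2 = nth v0 s i.+1]}.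
Proof.
case: p => // e0 q /and3P[_ /(pathP e0) epq up].
exists e0, e0.1, (path_verts (e0 :: q)); split=> // e /(nthP e0)[i isz <-].
exists i; split=> //; first by rewrite /= size_map.
  case: i isz => [//|i] isz; rewrite /= -(eqP (epq i isz)).
  by rewrite -(nth_map e0 e0.1 snd) // ltnW.
by rewrite -(nth_map e0 e0.1 snd).
Qed.

Lemma simple_path_rank P p : simple_path P p ->
  exists r : T -> nat, {in p, forall e, r e.2 = (r e.1).+1}.
Proof.
move=> /simple_path_nth[e0 [v0 [s [us sP]]]]; exists (fun v => index v s) => e.
move=> /sP[i [isz _ -> ->]]; rewrite !index_uniq //; exact: ltnW.
Qed.

Lemma simple_path_inj P p : simple_path P p ->
  {in p &, injective fst} /\ {in p &, injective snd}.
Proof.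
move=> /simple_path_nth[e0 [v0 [s [us sP]]]].
split=> e f /sP[i [isz ei ei1 ei2]] /sP[j [jsz fj fj1 fj2]].
  rewrite ei1 fj1 => /eqP; rewrite nth_uniq // 1?ltnW // => /eqP ij.
  by rewrite ei fj ij.
by rewrite ei2 fj2 => /eqP; rewrite nth_uniq // eqSS => /eqP ij; rewrite ei fj ij.
Qed.

Definition linear_digraph P : Prop :=
  [/\ {in edges P &, injective fst}, {in edges P &, injective snd}
    & forall c, ~~ oriented_cycle P c].

Section LinearOfMultipath.
Variables (G P : digraph T).
Hypothesis mP : multipath G P.

Lemma multipath_edge e : e \in edges P ->
  exists2 p, simple_path P p & comp_edges P e.1 = [set f in p].
Proof.
move=> Pe; have [e1 _ ne] := edgeP Pe; have [_ _ /(_ _ e1)] := mP.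
case=> [c1|[p [sp _ ep]]]; last by exists p.
have : e.2 \in comp_verts P e.1 by rewrite inE edge_connect.
by rewrite c1 inE eq_sym (negbTE ne).
Qed.

Lemma multipath_linear : linear_digraph P.
Proof.
split=> [e f Pe Pf ef|e f Pe Pf ef|c].
- have [p sp ep] := multipath_edge Pe.
  have pe : e \in p by have := in_set (mem p) e; rewrite -ep !inE Pe connect0.
  have pf : f \in p by have := in_set (mem p) f; rewrite -ep !inE Pf ef connect0.
  exact: (simple_path_inj sp).1.
- have [p sp ep] := multipath_edge Pe.
  have pe : e \in p by have := in_set (mem p) e; rewrite -ep !inE Pe connect0.
  have pf : f \in p.
    have := in_set (mem p) f; rewrite -ep !inE Pf /=.
    by rewrite (connect_trans (edge_connect Pe)) // connect_adjC ef edge_connect.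
  exact: (simple_path_inj sp).2.
apply/negP => /andP[]; case: c => // x c _ /andP[cyc uc].
have Pn y : y \in x :: c -> (y, next (x :: c) y) \in edges P.
  exact: (next_cycle cyc).
have con y : y \in x :: c -> connect (adj P) x y.
  have : path (adj P) x c.
    apply: sub_path (_ : path (edge_rel P) x c).
      by move=> u v uv; rewrite /adj -[(u, v) \in _]/(edge_rel P u v) uv.
    by move: cyc; rewrite /= rcons_path => /andP[].
  move=> xc yc; case/splitPl: yc xc => p1 p2 <-; rewrite cat_path => /andP[xp1 _].
  by apply/connectP; exists p1.
have [p sp ep] := multipath_edge (Pn x (mem_head _ _)).
have pP y : y \in x :: c -> (y, next (x :: c) y) \in p.
  move=> yc; have := in_set (mem p) (y, next (x :: c) y).
  by rewrite -ep !inE Pn //= con.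
have [r rE] := simple_path_rank sp.
have [y yc ymax] : exists2 y, y \in x :: c & forall z, z \in x :: c -> r z <= r y.
  have xc : x \in [set z in x :: c] by rewrite inE mem_head.
  case: (@arg_maxnP _ x (mem [set z in x :: c]) r xc) => y yc ymax.
  by exists y => [|z zc]; [move: yc; rewrite /= inE | apply: ymax; rewrite /= inE].
have := ymax _ (etrans (mem_next (x :: c) y) yc).
by rewrite (rE _ (pP _ yc)) ltnn.
Qed.

End LinearOfMultipath.

Section MultipathOfLinear.
Variables (G P : digraph T).
Hypotheses (PG : subdigraph P G) (vP : verts P = verts G).
Hypothesis linP : linear_digraph P.

Lemma linear_no_cycle x s : path (edge_rel P) x s -> uniq (x :: s) ->
  forall w, w \in x :: s -> ~~ edge_rel P (last x s) w.
Proof.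
have [_ _ acyc] := linP; move=> xs us w ws; apply/negP => lw.
case/splitPl: ws xs us lw => p1 p2 lp1; rewrite cat_path last_cat lp1.

move=> /andP[xp1 wp2] us lw; move: (acyc (w :: p2)) => /negP; apply.
apply/andP; split=> //; apply/andP; split; first by rewrite /= rcons_path wp2.
have : subseq (w :: p2) (x :: p1 ++ p2).
  rewrite -cat_cons (lastI x p1) lp1 cat_rcons; exact: suffix_subseq.
by move=> /subseq_uniq; apply.
Qed.

Lemma linear_component v : v \in verts P ->
  comp_verts P v = [set v] \/
  exists p, [/\ simple_path P p, comp_verts P v = [set x in path_verts p]
              & comp_edges P v = [set e in p]].
Proof.
move=> Pv; have [inj1 inj2 _] := linP.
pose good (n : nat) := `[< exists x s, [/\ path (edge_rel P) x s, uniq (x :: s),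
                                          v \in x :: s & size s = n] >].
have good0 : exists n, good n.
  by exists 0; apply/asboolP; exists v, [::]; rewrite mem_head.
have goodB n : good n -> n <= #|T|.
  move=> /asboolP[x [s [_ us _ <-]]]; apply/ltnW.
  by rewrite -[_.+1]/(size (x :: s)) -(card_uniqP us) max_card.
case: (ex_maxnP good0 goodB) => n /asboolP[x [s [xs us vs sn]]] nmax.
pose S := [set y in x :: s].
have lastN w : ~~ edge_rel P (last x s) w.
  have [ws|ws] := boolP (w \in x :: s); first exact: linear_no_cycle.
  apply/negP => lw; have : good n.+1.
    apply/asboolP; exists x, (rcons s w); split.
    - by rewrite rcons_path xs.
    - by rewrite -rcons_cons rcons_uniq ws.
    - by rewrite -rcons_cons mem_rcons inE vs orbT.
    - by rewrite size_rcons sn.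
  by move=> /nmax; rewrite ltnn.
have firstN w : ~~ edge_rel P w x.
  apply/negP => wx; have [ws|ws] := boolP (w \in x :: s).
    case/splitPl: ws xs us => p1 p2 lp1; rewrite cat_path lp1 => /andP[xp1 _].
    rewrite -cat_cons cat_uniq => /andP[up1 _].
    by have := linear_no_cycle xp1 up1 (mem_head _ _); rewrite lp1 wx.
  have : good n.+1.
    apply/asboolP; exists w, (x :: s); split=> //=.
    - by rewrite wx.
    - by rewrite ws.
    - by rewrite inE vs orbT.
    - by rewrite sn.
  by move=> /nmax; rewrite ltnn.
pose p := pairmap pair x s.
have outS e : e \in edges P -> e.1 \in x :: s -> e \in p.
  case: e => a b /= Pab as_; rewrite /p.
  case/splitPl: as_ xs lastN => p1 [|y p2] lp1.
    by rewrite cats0 lp1 => _ /(_ b)/negP[].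
  rewrite cat_path lp1 /= => /and3P[_ ay _] _.
  have /= [->] := inj1 _ _ Pab ay (erefl _).
  by rewrite pairmap_cat mem_cat lp1 /= inE eqxx orbT.
have inS e : e \in edges P -> e.2 \in x :: s -> e \in p.
  case: e => b a /= Pba as_; rewrite /p.
  case/splitPl: as_ xs => p1 p2; case: (lastP p1) => [|q y].
    by move=> /= E; have /negP[] := firstN b; rewrite E.
  rewrite last_rcons => ->; rewrite cat_path rcons_path => /andP[/andP[_ ya] _].
  have /= [->] := inj2 _ _ Pba ya (erefl _).
  by rewrite pairmap_cat mem_cat -cats1 pairmap_cat mem_cat /= inE eqxx orbT.
have pE q y : path (edge_rel P) y q -> {in pairmap pair y q, forall e,
    [/\ e \in edges P, e.1 \in y :: q & e.2 \in y :: q]}.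
  elim: q y => //= z q IHq y /andP[yz zq] e.
  rewrite inE => /predU1P[->|/(IHq z zq)[Pe e1 e2]]; last first.
    by split=> //; rewrite inE ?e1 ?e2 orbT.
  by split; rewrite // !inE eqxx ?orbT.
have xcon y : y \in x :: s -> connect (adj P) x y.
  move=> ys; case/splitPl: ys xs => p1 p2 <-; rewrite cat_path => /andP[xp1 _].
  apply/connectP; exists p1 => //; apply: sub_path xp1 => a b.
  by rewrite /adj /edge_rel => ->.
have compS : comp_verts P v = [set y in x :: s].
  apply/setP => w; rewrite !inE -[_ || _]/(w \in x :: s).
  apply/idP/idP => [|ws]; last first.
    by apply: connect_trans (xcon w ws); rewrite connect_adjC xcon.
  move=> /connectP[q vq ->].
  suff step u : path (adj P) u q -> u \in x :: s -> last u q \in x :: s by exact: step.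
  elim: q u {vq} => //= y q IHq u /andP[uy yq] us'.
  apply: IHq => //; case/orP: uy => [uy|yu].
    by have [] := pE s x xs _ (outS (u, y) uy us').
  by have [] := pE s x xs _ (inS (y, u) yu us').
case s0 : s => [|z s1].
  left; move: vs compS; rewrite s0 inE => /eqP-> ->.
  by apply/setP => w; rewrite !inE.
right; exists p.
have psnd (q : seq T) y : [seq f.2 | f <- pairmap pair y q] = q.
  by elim: q y => //= a q IHq y; rewrite IHq.
have pv : path_verts p = x :: s by rewrite /p s0 /= psnd.
have ppath q a b : path (fun f g : T * T => f.2 == g.1) (a, b) (pairmap pair b q).
  by elim: q a b => //= c q IHq a b; rewrite eqxx IHq.
split; last 2 first.
- by rewrite compS pv.
- apply/setP => e; rewrite [in LHS]inE compS !inE -[_ || _]/(e.1 \in x :: s).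
  apply/andP/idP => [[Pe es]|/(pE s x xs)[]//]; exact: outS.
have allP' : all (mem (edges P)) p by apply/allP => e /(pE s x xs)[].
move: allP' pv us; rewrite /p s0 => al pv us; apply/and3P; split=> //.
by rewrite pv.
Qed.

Lemma linear_multipath : multipath G P.
Proof. by split=> // v; exact: linear_component. Qed.

End MultipathOfLinear.

Lemma multipathP G P : multipath G P <->
  [/\ subdigraph P G, verts P = verts G & linear_digraph P].
Proof.
split=> [mP|[]]; last by move=> *; exact: linear_multipath.
by have [? ? _] := mP; split=> //; exact: (multipath_linear mP).
Qed.

End MultipathTheory.

(** * Dynamical modules *)

Section Modules.
Context {T : finType}.
Implicit Types (G R M : digraph T).

Definition endpoints (E : {set T * T}) : {set T} :=
  [set e.1 | e in E] :|: [set e.2 | e in E].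

Lemma complement_subproof G R :
  digraph_axiom (endpoints (edges G :\: edges R), edges G :\: edges R).
Proof.
apply/forall_inP => e /= eGR.
have [_ _ ->] : [/\ e.1 \in verts G, e.2 \in verts G & e.1 != e.2].
  by apply: edgeP; move: eGR; rewrite inE => /andP[].
by rewrite !inE (imset_f fst eGR) (imset_f snd eGR) orbT.
Qed.

Definition complement G R : digraph T := Digraph (complement_subproof G R).

Definition boundary G R : {set T} := verts R :&: verts (complement G R).

(* Dynamical regions are not required to be induced (full) subgraphs.  With that
   extra requirement decompositions into dynamical modules need not exist: in
   the digraph with edges x->a, x->y, z->y, z->w, b->w, a->b, the induced
   subgraph on {a, b} is a region, and every region containing x->a contains
   the other edges at x, y, z and w by the boundary condition, hence a and b,
   hence would contain a->b if induced; so no minimal one contains x->a. *)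
Definition dynamical_region G R : Prop :=
  [/\ subdigraph R G, connected_digraph R, edges R != set0,
      forall v, v \in boundary G R ->
        [/\ unstable G v, stable R v & stable (complement G R) v]
    & forall c, oriented_cycle G c -> cycle_edges c :&: edges R != set0 ->
        cycle_edges c \subset edges R].

Definition dynamical_module G M : Prop :=
  dynamical_region G M /\
  forall R, dynamical_region G R -> subdigraph R M -> R = M.

Definition module_decomposition G (Ms : seq (digraph T)) : Prop :=
  [/\ {in Ms, forall M, dynamical_module G M},
      \bigcup_(M <- Ms) edges M = edges G
    & pairwise (fun M N => [disjoint edges M & edges N]) Ms].

End Modules.

(** * Simplicial complexes *)

Record complex (V : finType) := Complex {
  simplices :> {set {set V}};
  _ : set0 \notin simplices;
  _ : forall v, [set v] \in simplices;
  _ : forall A B : {set V},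
        B \in simplices -> A \subset B -> A != set0 -> A \in simplices
}.

Section MultipathComplex.
Context {T : finType}.
Variable G : digraph T.

Definition multipath_simplices : {set {set {e : T * T | e \in edges G}}} :=
  [set A | (A != set0) &&
     `[< exists2 P, multipath G P & edges P = [set val e | e in A] >]].

Lemma spanning_subproof (A : {set {e : T * T | e \in edges G}}) :
  digraph_axiom (verts G, [set val e | e in A]).
Proof.
apply/forall_inP => e /= /imsetP[[f Gf] _ ->] /=.
by have [-> ->] := edgeP Gf.
Qed.

Lemma multipath_simplices0 : set0 \notin multipath_simplices.
Proof. by rewrite inE eqxx. Qed.

Lemma multipath_simplices1 v : [set v] \in multipath_simplices.
Proof.
rewrite inE -card_gt0 cards1; apply/asboolP.
exists (Digraph (spanning_subproof [set v])) => //.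
apply/multipathP; split=> //.
  by apply/andP; split=> //; apply/subsetP => e /imsetP[f _ ->]; exact: valP.
have E e : e \in edges (Digraph (spanning_subproof [set v])) -> e = val v.
  by rewrite /edges /= imset_set1 inE => /eqP.
split=> [e f /E-> /E->//|e f /E-> /E->//|c].
apply/negP => /andP[]; case: c => // x c _ /andP[cyc _].
have yP y : y \in x :: c -> (y, next (x :: c) y) = val v.
  by move=> /(next_cycle cyc)/E.
have [_ _] := edgeP (valP v); rewrite -(yP x (mem_head _ _)) /= => /eqP; apply.
have xc : next (x :: c) x \in x :: c by rewrite mem_next mem_head.
by have := yP x (mem_head _ _); rewrite -(yP _ xc) => -[].
Qed.

Lemma multipath_simplices_down (A B : {set {e : T * T | e \in edges G}}) :
  B \in multipath_simplices -> A \subset B -> A != set0 ->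
  A \in multipath_simplices.
Proof.
rewrite !inE => /andP[_ /asboolP[P /multipathP[PG vP [i1 i2 acyc]] eP]] AB -> /=.
apply/asboolP; exists (Digraph (spanning_subproof A)) => //.
have sub e : e \in edges (Digraph (spanning_subproof A)) -> e \in edges P.
  by rewrite eP; exact/subsetP/imsetS.
apply/multipathP; split=> //.
  by apply/andP; split=> //; apply/subsetP => e /imsetP[f _ ->]; exact: valP.
split=> [e f /sub Pe /sub|e f /sub Pe /sub|c]; [exact: i1|exact: i2|].
apply: contra (acyc c) => /andP[c0 /andP[cyc uc]]; apply/andP; split=> //.
by apply/andP; split=> //; apply: sub_cycle cyc => u v; exact: sub.
Qed.

Definition multipath_complex : complex {e : T * T | e \in edges G} :=
  Complex multipath_simplices0 multipath_simplices1 multipath_simplices_down.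

End MultipathComplex.

Section Join.
Context {I : finType} {V : I -> finType}.
Variable K : forall i, complex (V i).

Definition slice i (A : {set {i : I & V i}}) : {set V i} :=
  [set v | Tagged V v \in A].

(* The vertex set of the join is the disjoint union of the vertex sets. *)
Definition join_simplices : {set {set {i : I & V i}}} :=
  [set A | (A != set0) &&
     [forall i, (slice i A == set0) || (slice i A \in simplices (K i))]].

Lemma join_simplices0 : set0 \notin join_simplices.
Proof. by rewrite inE eqxx. Qed.

Lemma join_simplices1 u : [set u] \in join_simplices.
Proof.
case: u => i v; rewrite inE -card_gt0 cards1; apply/forallP => j.
have [eij|ij] := eqVneq i j; last first.
  apply/orP; left; apply/eqP/setP => w; rewrite !inE.
  by apply/negP => /eqP/(congr1 tag)/= /esym/eqP; rewrite (negbTE ij).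
case: _ / eij; apply/orP; right.
have -> : slice i [set existT (fun i => V i) i v] = [set v].
  by apply/setP => w; rewrite !inE eq_Tagged.
by case: (K i).
Qed.

Lemma join_simplices_down (A B : {set {i : I & V i}}) :
  B \in join_simplices -> A \subset B -> A != set0 -> A \in join_simplices.
Proof.
rewrite !inE => /andP[_ /forallP KB] /subsetP AB -> /=; apply/forallP => i.
have sAB : slice i A \subset slice i B.
  by apply/subsetP => v; rewrite !inE; exact: AB.
have [//|A0 /=] := eqVneq (slice i A) set0.
have /orP[/eqP B0|] := KB i; first by move: sAB; rewrite B0 subset0 (negbTE A0).
by case: (K i) => /= S _ _ down SB; exact: (down _ _ SB sAB A0).
Qed.

Definition simplicial_join : complex {i : I & V i} :=
  Complex join_simplices0 join_simplices1 join_simplices_down.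

End Join.

(** * Geometric realization and homotopy equivalence *)

Section Topology.
Local Open Scope classical_set_scope.
Local Open Scope ring_scope.

(* Barycentric coordinates, with the subspace topology of the product topology;
   as the vertex set is finite this is the usual topology of |K|. *)
Definition barycentric (R : realType) (V : finType) (K : complex V) :
    set {ptws V -> R} :=
  [set x | [/\ forall v, 0 <= x v, \sum_v x v = 1
             & [set v | x v != 0]%SET \in simplices K]].

Definition realization (R : realType) (V : finType) (K : complex V) :
    topologicalType :=
  classical_sets.set_type (barycentric K : set {ptws V -> R}).

Definition homotopic (R : realType) (X Y : topologicalType) (f g : X -> Y) : Prop :=
  exists H : R * X -> Y,
    [/\ {within `[0, 1]%classic `*` [set: X], continuous H},
        forall x, H (0, x) = f x & forall x, H (1, x) = g x].

Definition homotopy_equivalent (R : realType) (X Y : topologicalType) : Prop :=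
  exists (f : X -> Y) (g : Y -> X),
    [/\ continuous f, continuous g,
        homotopic R (g \o f) id & homotopic R (f \o g) id].

End Topology.

Arguments realization R [V] K.

(** * Algorithms *)

(* The model of computation is the language I of N. D. Jones (Computability and
   Complexity: From a Programming Perspective, 1997): Turing-complete while
   programs over binary trees, with a single variable. *)
Inductive tree := Leaf | Node of tree & tree.

Fixpoint tree_eqb (s t : tree) : bool :=
  match s, t with
  | Leaf, Leaf => true
  | Node s1 s2, Node t1 t2 => tree_eqb s1 t1 && tree_eqb s2 t2
  | _, _ => false
  end.

Inductive expr :=
| EVar
| ENil
| ECons of expr & expr
| EHd of expr
| ETl of expr
| EEq of expr & expr.

Fixpoint eval (e : expr) (x : tree) : tree :=
  match e with
  | EVar => x
  | ENil => Leaf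
  | ECons e1 e2 => Node (eval e1 x) (eval e2 x)
  | EHd e1 => if eval e1 x is Node s _ then s else Leaf
  | ETl e1 => if eval e1 x is Node _ t then t else Leaf
  | EEq e1 e2 => if tree_eqb (eval e1 x) (eval e2 x) then Node Leaf Leaf else Leaf
  end.

Inductive program :=
| Assign of expr
| Seq of program & program
| While of expr & program.

(* run c x y: on input x, the program c terminates with output y. *)
Inductive run : program -> tree -> tree -> Prop :=
| run_assign e x : run (Assign e) x (eval e x)
| run_seq c1 c2 x y z : run c1 x y -> run c2 y z -> run (Seq c1 c2) x z
| run_while_false e c x : eval e x = Leaf -> run (While e c) x x
| run_while_true e c x y z : eval e x <> Leaf ->
    run c x y -> run (While e c) y z -> run (While e c) x z.

Definition code_nat (n : nat) : tree := iter n (Node Leaf) Leaf.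
Definition code_seq (s : seq tree) : tree := foldr Node Leaf s.

Section Coding.
Context {T : finType}.
Implicit Types (G H : digraph T).

(* Vertices are numbered by their positions in the list of vertices of the
   ambient digraph G, so that codes do not depend on T. *)
Definition code_vertex G (v : T) : tree := code_nat (index v (enum (verts G))).
Definition code_edge G (e : T * T) : tree :=
  Node (code_vertex G e.1) (code_vertex G e.2).

Definition code_subdigraph G H : tree :=
  Node (code_seq [seq code_vertex G v | v <- enum (verts H)])
       (code_seq [seq code_edge G e | e <- enum (edges H)]).

End Coding.

(* Main.v *)
(** Call two edges linked if they have the same source, or the same target, or if
    one lies on an oriented cycle and the other starts at its target.  A region is
    exactly a connected subgraph whose edge set is closed under this relation:
    condition (a) is closure under the first two kinds of links, and in their
    presence condition (b) amounts to the third one.  Hence the modules are the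
    classes of the equivalence relation generated by links.  Whether a set of
    edges is a multipath can be tested on each class, since two edges sharing
    their source or target, as well as all edges of an oriented cycle, belong to
    one class.  So X(G) is even isomorphic to the join.  The classes are found by
    iterating the link relation; programs for this are assembled from closure
    properties of the functions on trees computable in the language I, notably
    under pairing and folds over lists. *)

From HB Require Import structures.
Require Import Defs.
From mathcomp Require Import all_boot all_order all_algebra.
From mathcomp Require Import all_classical all_reals all_analysis.
From mathcomp Require Import fintype finset.

Set Implicit Arguments.
Unset Strict Implicit.
Unset Printing Implicit Defensive.

Import numFieldNormedType.Exports.

(** * Dynamical modules are link classes *)

Section Link.
Context {T : finType}.
Variable G : digraph T.
Implicit Types (R M : digraph T) (e f : T * T) (v : T) (c : seq T).

(* e lies on a cycle and f starts where e ends.  No cycle need contain both, but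
   f has the same source as the successor of e on a cycle, so that every region
   containing e contains f. *)
Definition follows e f : bool :=
  (e.2 == f.1) && connect (edge_rel G) e.2 e.1.

Definition link e f : bool :=
  [&& e \in edges G, f \in edges G &
      [|| e.1 == f.1, e.2 == f.2, follows e f | follows f e]].

Lemma link_sym : symmetric link.
Proof.
move=> e f; rewrite /link andbCA; congr [&& _, _ & _].
by rewrite (eq_sym e.1) (eq_sym e.2) (orbC (follows e f)).
Qed.

Lemma connect_linkC : connect_sym link.
Proof. exact/sym_connect_sym/link_sym. Qed.

Lemma connect_link_edge e f :
  e \in edges G -> connect link e f -> f \in edges G.
Proof.
move=> Ge /connectP[p]; elim: p e Ge => [|g p IHp] e Ge /= => [_ ->//|].
by case/andP=> /and3P[_ Gg _]; exact: IHp.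
Qed.

(** A duplicate-free path from the target of [e] back to its source, closed up by [e], is the cycle.
    That [e.2] lies on it is recorded so that the successor of [e] on the cycle can be named. *)
Lemma edge_on_cycle e : e \in edges G -> connect (edge_rel G) e.2 e.1 ->
  exists c, [/\ oriented_cycle G c, e \in cycle_edges c & e.2 \in c].
Proof.
move=> Ge /connectP[p vp lp]; have [_ _ ne] := edgeP Ge.
case: (shortenP vp) lp => p' vp' up' _ lp.
have [x [q Ep]] : exists x q, p' = x :: q.
  by case: p' lp {vp' up'} => [E|x q _]; [rewrite E eqxx in ne | exists x, q].
have E : rcons (belast e.2 p') e.1 = e.2 :: p' by rewrite lp -lastI.
exists (e.1 :: belast e.2 p'); split.
- apply/andP; split=> //; apply/andP; split; last first.
    by rewrite /= -rcons_uniq E.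
  by rewrite /= E /= vp' andbT -[edge_rel _ _ _]/((e.1, e.2) \in _) -surjective_pairing.
- apply/imsetP; exists e.1; first by rewrite mem_head.
  by rewrite Ep /= eqxx; case: (e).
- by rewrite Ep !inE eqxx orbT.
Qed.

(** * Chains of links along an oriented cycle *)

Lemma iter_next_mem c n v : v \in c -> iter n (next c) v \in c.
Proof. by move=> cv; elim: n => //= n; rewrite mem_next. Qed.

Lemma cycle_iter c v w : uniq c -> v \in c -> w \in c ->
  exists n, w = iter n (next c) v.
Proof.
move=> uc cv cw; have : fconnect (next c) v w.
  by rewrite (fconnect_cycle (cycle_next uc) cv).
by move=> /iter_findex <-; exists (findex (next c) v w).
Qed.

Lemma cycle_edge c v : oriented_cycle G c -> v \in c -> (v, next c v) \in edges G.
Proof. by case/andP=> _ /andP[cyc _]; exact: (next_cycle cyc). Qed.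

Lemma cycle_connect c v w : oriented_cycle G c -> v \in c -> w \in c ->
  connect (edge_rel G) v w.
Proof.
move=> oc cv cw; have /andP[_ /andP[_ uc]] := oc.
have [n ->] := cycle_iter uc cv cw.
elim: n => //= n IHn; apply: connect_trans IHn _.
by apply: connect1; apply: cycle_edge => //; exact: iter_next_mem.
Qed.

(** Each edge of a cycle [follows] into the next one, since the rest of the cycle leads back to its
    source. *)
Lemma cycle_connect_link c v w : oriented_cycle G c -> v \in c -> w \in c ->
  connect link (v, next c v) (w, next c w).
Proof.
move=> oc cv cw; have /andP[_ /andP[_ uc]] := oc.
have [n ->] := cycle_iter uc cv cw.
elim: n => //= n IHn; apply: connect_trans IHn _; apply: connect1.
have cn := iter_next_mem n cv; set u := iter n _ v in cn *.
have cu : next c u \in c by rewrite mem_next.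
rewrite /link !(cycle_edge oc) //=; apply/or4P; apply: Or43.
by rewrite /follows /= eqxx (cycle_connect oc).
Qed.

(** * Dynamical regions as connected link-closed subgraphs *)

Definition link_closed (S : {set T * T}) : Prop :=
  forall e f, e \in S -> link e f -> f \in S.

Lemma link_closed_connect S e f :
  link_closed S -> e \in S -> connect link e f -> f \in S.
Proof.
move=> clS Se /connectP[p]; elim: p e Se => [|g p IHp] e Se /= => [_ ->//|].
by case/andP=> /(clS _ _ Se); exact: IHp.
Qed.

Lemma indeg0P R v : reflect {in edges R, forall e, e.2 != v} (indeg R v == 0).
Proof.
rewrite cards_eq0; apply: (iffP eqP) => [E e Re|E].
  by apply/negP => ev; have := in_set0 e; rewrite -E inE Re ev.
by apply/setP => e; rewrite !inE; apply/negP => /andP[/E/negP].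
Qed.

Lemma outdeg0P R v : reflect {in edges R, forall e, e.1 != v} (outdeg R v == 0).
Proof.
rewrite cards_eq0; apply: (iffP eqP) => [E e Re|E].
  by apply/negP => ev; have := in_set0 e; rewrite -E inE Re ev.
by apply/setP => e; rewrite !inE; apply/negP => /andP[/E/negP].
Qed.

Lemma endpointsP (E : {set T * T}) v :
  reflect (exists2 e, e \in E & v = e.1 \/ v = e.2) (v \in endpoints E).
Proof.
apply: (iffP setUP) => [[]/imsetP[e Ee ->]|[e Ee [->|->]]].
- by exists e => //; left.
- by exists e => //; right.
- by left; exact: imset_f.
- by right; exact: imset_f.
Qed.

(** Once there is an edge, connectedness rules out isolated vertices. A region is therefore
    determined by its edge set. *)
Lemma connected_endpoints R : connected_digraph R -> edges R != set0 ->
  verts R = endpoints (edges R).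
Proof.
move=> cR /set0Pn[e Re]; have [Re1 _ _] := edgeP Re.
apply/setP => v; apply/idP/endpointsP => [Rv|[f /edgeP[f1 f2 _] [->|->]]] //.
have /connectP[[|w p] /= vp lp] := cR _ _ Rv Re1; first by exists e; auto.
case/andP: vp => /orP[] vw _; first by exists (v, w); auto.
by exists (w, v); auto.
Qed.

(** If [f] were outside [R], then [v] would be a boundary vertex. Say both edges leave [v]:
    stability in [R] and in the complement then excludes incoming edges in either, so [v] would be
    stable in [G]. Incoming edges are treated dually. *)
Lemma region_share R v e f : dynamical_region G R ->
  e \in edges R -> f \in edges G ->
  (e.1 == v) && (f.1 == v) || (e.2 == v) && (f.2 == v) -> f \in edges R.
Proof.
case=> _ _ _ bR _ Re Gf sh; apply/negPn/negP => Rf.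
have CRf : f \in edges (complement G R) by rewrite inE Rf Gf.
have : v \in boundary G R.
  have [e1 e2 _] := edgeP Re; have [f1 f2 _] := edgeP CRf.
  rewrite inE; case/orP: sh => /andP[/eqP ev /eqP fv]; apply/andP.
    by split; [rewrite -ev | rewrite -fv].
  by split; [rewrite -ev | rewrite -fv].
case/bR => /negP uG sR sC; apply: uG; case/orP: sh => /andP[ev fv].
  apply/orP; left; apply/indeg0P => g Gg.
  case/orP: sR => [/indeg0P iR|/outdeg0P/(_ e Re)]; last by rewrite ev.
  case/orP: sC => [/indeg0P iC|/outdeg0P/(_ f CRf)]; last by rewrite fv.
  have [/iR//|Rg] := boolP (g \in edges R).
  by apply: iC; rewrite inE Rg Gg.
apply/orP; right; apply/outdeg0P => g Gg.
case/orP: sR => [/indeg0P/(_ e Re)|/outdeg0P oR]; first by rewrite ev.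
case/orP: sC => [/indeg0P/(_ f CRf)|/outdeg0P oC]; first by rewrite fv.
have [/oR//|Rg] := boolP (g \in edges R).
by apply: oC; rewrite inE Rg Gg.
Qed.

(* Condition (a) says that, at each vertex, R contains all or none of the
   incoming edges and all or none of the outgoing ones. *)
Lemma regionP R : dynamical_region G R <->
  [/\ subdigraph R G, connected_digraph R, edges R != set0
    & link_closed (edges R)].
Proof.
split=> [rR|[sR cR nR clR]].
  have [sR cR nR _ cycR] := rR; split=> // e f Re /and3P[Ge Gf].
  have cl1 g h : g \in edges R -> h \in edges G -> g.1 = h.1 -> h \in edges R.
    by move=> Rg Gh E; apply: (region_share rR Rg Gh (v := h.1)); rewrite E eqxx.
  have meets c g h : oriented_cycle G c -> g \in cycle_edges c ->
      g \in edges R -> h \in cycle_edges c -> h \in edges R.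
    move=> oc cg Rg; apply/subsetP/(cycR _ oc).
    by apply/set0Pn; exists g; rewrite inE cg.
  case/or4P => [/eqP|/eqP E|/andP[/eqP E con]|/andP[/eqP E con]].
  - exact: cl1.
  - by apply: (region_share rR Re Gf (v := f.2)); rewrite E eqxx orbT.
  (* The cycle through [e] lies in [R] by condition (b), and its edge leaving [e.2] has the same
     source as [f]. *)
  - have [c [oc ec vc]] := edge_on_cycle Ge con.
    apply: (cl1 (e.2, next c e.2)) => //.
    by apply: (meets c e) => //; exact: imset_f.
  (* Conversely, the edge leaving [f.2] on the cycle through [f] shares its source with [e], hence
     is in [R]; condition (b) then brings in [f]. *)
  - have [c [oc fc vc]] := edge_on_cycle Gf con.
    apply: (meets c (f.2, next c f.2)) => //; first exact: imset_f.
    by apply: (cl1 e) => //; exact: cycle_edge.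
have /andP[_ /subsetP sE] := sR; split=> //.
  move=> v; rewrite inE => /andP[]; rewrite connected_endpoints //.
  move=> /endpointsP[e Re ev] /endpointsP[f CRf fv].
  have /setDP[Gf Rf] := CRf.
  have sep1 g h : g \in edges R -> h \in edges (complement G R) -> g.1 != h.1.
    move=> Rg /setDP[Gh /negP Rh]; apply/negP => E; apply: Rh.
    by apply: (clR _ _ Rg); rewrite /link (sE _ Rg) Gh E.
  have sep2 g h : g \in edges R -> h \in edges (complement G R) -> g.2 != h.2.
    move=> Rg /setDP[Gh /negP Rh]; apply/negP => E; apply: Rh.
    by apply: (clR _ _ Rg); rewrite /link (sE _ Rg) Gh E orbT.
  (* A boundary vertex is an end of [e] in [R] and of [f] outside. Closure forbids it to be the
     source of both or the target of both; in the two mixed cases closure gives stability on each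
     side. *)
  have Ge := sE _ Re; case: ev fv (sep1 e f) (sep2 e f) => -> [] E s1 s2.
  - by have := s1 Re CRf; rewrite E eqxx.
  - split.
    + by apply/negP => /orP[/indeg0P/(_ f Gf)|/outdeg0P/(_ e Ge)]; rewrite -?E eqxx.
    + by apply/orP; left; apply/indeg0P => g Rg; rewrite E sep2.
    + by apply/orP; right; apply/outdeg0P => g Cg; rewrite eq_sym sep1.
  - split.
    + by apply/negP => /orP[/indeg0P/(_ e Ge)|/outdeg0P/(_ f Gf)]; rewrite -?E eqxx.
    + by apply/orP; right; apply/outdeg0P => g Rg; rewrite E sep1.
    + by apply/orP; left; apply/indeg0P => g Cg; rewrite eq_sym sep2.
  - by have := s2 Re CRf; rewrite E eqxx.
move=> c oc /set0Pn[_ /setIP[/imsetP[v cv ->] Rv]].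
apply/subsetP => _ /imsetP[w cw ->].
by apply: (link_closed_connect clR Rv); exact: cycle_connect_link.
Qed.

(** * Link classes are exactly the dynamical modules *)

Definition link_class e : {set T * T} :=
  [set f in edges G | connect link e f].

Lemma link_module_subproof e :
  digraph_axiom (endpoints (link_class e), link_class e).
Proof.
apply/forall_inP => f /= ef.
have [_ _ ->] : [/\ f.1 \in verts G, f.2 \in verts G & f.1 != f.2].
  by apply: edgeP; move: ef; rewrite inE => /andP[].
by rewrite andbT; apply/andP; split; apply/endpointsP; exists f; auto.
Qed.

Definition link_module e : digraph T := Digraph (link_module_subproof e).

Lemma link_module_sub e : subdigraph (link_module e) G.
Proof.
apply/andP; split; last by apply/subsetP => f /setIdP[].
apply/subsetP => v /endpointsP[f /setIdP[Gf _]].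
by have [f1 f2 _] := edgeP Gf => -[] ->.
Qed.

Lemma link_module_mem e : e \in edges G -> e \in edges (link_module e).
Proof. by move=> Ge; rewrite inE Ge connect0. Qed.

Lemma link_module_eq e f : connect link e f -> link_module e = link_module f.
Proof.
move=> ef; have E : link_class e = link_class f.
  apply/setP => g; rewrite !inE; congr (_ && _).
  exact: (same_connect connect_linkC).
by apply: val_inj; rewrite /= E.
Qed.

Lemma link_module_edge_eq e f :
  f \in edges (link_module e) -> link_module e = link_module f.
Proof. by case/setIdP=> _; exact: link_module_eq. Qed.

Lemma link_class_closed e : link_closed (edges (link_module e)).
Proof.
move=> f g /setIdP[_ ef] fg; rewrite inE (connect_trans ef (connect1 fg)).
by case/and3P: fg => _ ->.
Qed.

(** Linked edges have a common endpoint, so a chain of links yields an undirected walk joining the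
    sources of its edges. *)
Lemma link_module_connected e : e \in edges G -> connected_digraph (link_module e).
Proof.
move=> Ge; have Me := link_module_mem Ge; set M := link_module e in Me *.
suff con f : connect link e f -> connect (adj M) e.1 f.1.
  have con' v : v \in verts M -> connect (adj M) e.1 v.
    move=> /endpointsP[f Mf]; have /setIdP[_ /con ef] := Mf.
    by case=> -> //; exact: connect_trans ef (edge_connect (Mf : f \in edges M)).
  move=> u v /con' eu /con'; apply: connect_trans.
  by rewrite connect_adjC.
move=> /connectP[p]; elim/last_ind: p f => [|p g IHp] f /=; first by move=> _ ->.
rewrite rcons_path last_rcons => /andP[ep pg ->].
have Mf : last e p \in edges M.
  rewrite inE; have pe : connect link e (last e p) by apply/connectP; exists p.
  by rewrite pe (connect_link_edge Ge pe).
apply: connect_trans (IHp _ ep erefl) _.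
have Mg : g \in edges M by exact: link_class_closed Mf pg.
have cf := edge_connect Mf; have cg := edge_connect Mg.
case/and3P: pg => _ _ /or4P[/eqP->|/eqP E|/andP[/eqP <- _ //]|/andP[/eqP <- _]].
- exact: connect0.
- by apply: connect_trans cf _; rewrite connect_adjC E.
- by rewrite connect_adjC.
Qed.

Lemma link_module_region e : e \in edges G -> dynamical_region G (link_module e).
Proof.
move=> Ge; apply/regionP; split.
- exact: link_module_sub.
- exact: link_module_connected.
- by apply/set0Pn; exists e; exact: link_module_mem.
- exact: link_class_closed.
Qed.

Lemma region_link_module R e : dynamical_region G R -> e \in edges R ->
  subdigraph (link_module e) R.
Proof.
move=> /regionP[sR cR nR clR] Re; apply/andP.
have sub : edges (link_module e) \subset edges R.
  by apply/subsetP => f /setIdP[_]; exact: link_closed_connect.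
split=> //; rewrite (connected_endpoints cR nR).
apply/subsetP => v /endpointsP[f /(subsetP sub) Rf E].
by apply/endpointsP; exists f.
Qed.

Lemma module_link_module M e : dynamical_module G M -> e \in edges M ->
  M = link_module e.
Proof.
move=> [rM minM] Me; apply/esym/minM; last exact: region_link_module.
apply: link_module_region.
by case: rM => /andP[_ /subsetP sM] _ _ _ _; exact: sM.
Qed.

(** A region inside the class has some edge [f] and so contains the whole class of [f], which is the
    class of [e]. This gives minimality. *)
Lemma link_module_dynamical e : e \in edges G -> dynamical_module G (link_module e).
Proof.
move=> Ge; split=> [|R rR sR]; first exact: link_module_region.
have [/andP[_ sG] cR /set0Pn[f Rf] _ _] := rR.
have ef : link_module e = link_module f.
  by apply: link_module_edge_eq; case/andP: sR => _ /subsetP; exact.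
have /andP[v1 e1] := region_link_module rR Rf.
have /andP[v2 e2] := sR; rewrite ef in v2 e2.
have vE : verts R = verts (link_module e).
  by apply/eqP; rewrite ef eqEsubset v2.
have eE : edges R = edges (link_module e).
  by apply/eqP; rewrite ef eqEsubset e2.
by apply: val_inj; rewrite /= [digraph_val R]surjective_pairing -/(verts R) -/(edges R) vE eE.
Qed.

(** * Existence and uniqueness of the decomposition *)

Definition link_modules : seq (digraph T) :=
  undup [seq link_module e | e <- enum (edges G)].

Lemma link_modulesP M :
  reflect (exists2 e, e \in edges G & M = link_module e) (M \in link_modules).
Proof.
rewrite mem_undup; apply: (iffP mapP) => -[e].
  by rewrite mem_enum; exists e.
by exists e; rewrite ?mem_enum.
Qed.

Lemma bigcup_seqP (Ms : seq (digraph T)) e :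
  reflect (exists2 M, M \in Ms & e \in edges M) (e \in \bigcup_(M <- Ms) edges M).
Proof.
elim: Ms => [|M Ms IHMs]; first by rewrite big_nil inE; apply: ReflectF => -[].
rewrite big_cons inE; apply: (iffP orP) => [[eM|/IHMs[N MsN eN]]|[N]].
- by exists M; rewrite ?mem_head.
- by exists N; rewrite // inE MsN orbT.
- by rewrite inE => /predU1P[->|MsN eN]; [left | right; apply/IHMs; exists N].
Qed.

Lemma link_modules_decomposition : module_decomposition G link_modules.
Proof.
split.
- by move=> M /link_modulesP[e Ge ->]; exact: link_module_dynamical.
- apply/setP => e; apply/bigcup_seqP/idP => [[M /link_modulesP[f Gf ->]]|Ge].
    by case/setIdP.
  exists (link_module e); last exact: link_module_mem.
  by apply/link_modulesP; exists e.
have := undup_uniq [seq link_module e | e <- enum (edges G)].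
rewrite -/link_modules uniq_pairwise; apply: sub_in_pairwise (allss _).
move=> _ _ /link_modulesP[e Ge ->] /link_modulesP[f Gf ->] /=.
apply: contraR => /pred0Pn[g /andP[/= eg fg]].
by rewrite (link_module_edge_eq eg) (link_module_edge_eq fg).
Qed.

(** A module has an edge, so it is not disjoint from itself and cannot occur twice. *)
Lemma decomposition_uniq Ns : module_decomposition G Ns -> uniq Ns.
Proof.
case=> mN _; rewrite uniq_pairwise; apply: sub_in_pairwise (allss _).
move=> M N /mN[[_ _ nM _ _] _] _ /= dMN; apply: contraNneq nM => MN.
by rewrite -MN -setI_eq0 setIid in dMN.
Qed.

(** A module is the class of any of its edges. Conversely every edge of [G] is covered by a member
    of [Ns], which must be its class. *)
Lemma mem_decomposition Ns : module_decomposition G Ns -> Ns =i link_modules.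
Proof.
case=> mN cN _ M; apply/idP/link_modulesP => [NsM|[e Ge ->]].
  have mM := mN _ NsM; have [[/andP[_ /subsetP sM] _ /set0Pn[e Me] _ _] _] := mM.
  by exists e; [exact: sM | exact: module_link_module].
move: Ge; rewrite -cN => /bigcup_seqP[N NsN Ne].
by rewrite -(module_link_module (mN _ NsN) Ne).
Qed.

Lemma decomposition_perm Ns : module_decomposition G Ns -> perm_eq link_modules Ns.
Proof.
move=> dN; apply: uniq_perm; first exact: undup_uniq.
  exact: decomposition_uniq.
by move=> M; rewrite mem_decomposition.
Qed.

End Link.

(** * Isomorphic complexes have homotopy equivalent realizations *)

Section Homeomorphism.
Local Open Scope classical_set_scope.
Local Open Scope ring_scope.
Variable R : realType.

Lemma homotopic_refl (X : topologicalType) (f : X -> X) : f =1 id ->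
  homotopic R f id.
Proof.
move=> fE; exists snd; split=> //; apply: continuous_subspaceT => x.
exact: cvg_snd.
Qed.

Section Reindex.
Variables (V W : finType) (K : complex V) (L : complex W) (h : W -> V).
Hypothesis bij_h : bijective h.
Hypothesis simp : forall A : {set V},
  A \in simplices K -> [set w | h w \in A]%SET \in simplices L.

Lemma reindex_barycentric (x : {ptws V -> R}) :
  barycentric K x -> barycentric L (x \o h : {ptws W -> R}).
Proof.
case=> x0 x1 sx; split; first by move=> w; exact: x0.
  by rewrite -x1 [RHS](reindex h) //; exact: onW_bij.
have -> : [set w | (x \o h) w != 0]%SET = [set w | h w \in [set v | x v != 0]%SET]%SET.
  by apply/setP => w; rewrite !inE.
exact: simp.
Qed.

(** This is the map of realizations induced by the vertex map inverse to [h]. *)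
Definition reindex_realization (x : realization R K) : realization R L :=
  exist _ (set_val x \o h : {ptws W -> R})
    (mem_set (reindex_barycentric (set_valP x))).

(** Continuity into a subspace of a product is checked coordinatewise, and every coordinate of the
    image is a coordinate of the argument. *)
Lemma reindex_continuous : continuous reindex_realization.
Proof.
apply: continuous_comp_initial => x.
apply/cvg_sup; first by apply: fmap_filter; exact: nbhs_filter.
move=> w U [_ [[B oB <-]] /= Bx BU].
have hw : continuous ((fun y => set_val y (h w)) : realization R K -> R).
  move=> y; apply: (@continuous_comp _ {ptws V -> R} R set_val (proj (h w))).
    exact: initial_continuous.
  exact: proj_continuous.
have Bhx : nbhs (set_val x (h w)) B by exact: open_nbhs_nbhs.
apply: filterS BU _; first by apply: fmap_filter; exact: nbhs_filter.
exact: (hw x B Bhx).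
Qed.

End Reindex.

(** The two reindexing maps are mutually inverse, so homotopies constant in time suffice. *)
Lemma isomorphic_homotopy_equivalent (V W : finType) (K : complex V) (L : complex W)
    (h : W -> V) : bijective h ->
  (forall A : {set V}, ([set w | h w \in A]%SET \in simplices L) = (A \in simplices K)) ->
  homotopy_equivalent R (realization R K) (realization R L).
Proof.
move=> bij_h KL; have [g hK gK] := bij_h.
have bij_g : bijective g by exists h.
have simp A : A \in simplices K -> [set w | h w \in A]%SET \in simplices L by rewrite KL.
have simp' A : A \in simplices L -> [set v | g v \in A]%SET \in simplices K.
  rewrite -KL; have -> // : [set w | h w \in [set v | g v \in A]%SET]%SET = A.
  by apply/setP => w; rewrite !inE hK.
exists (reindex_realization bij_h simp), (reindex_realization bij_g simp'); split.
- exact: reindex_continuous.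
- exact: reindex_continuous.
- apply: homotopic_refl => x; apply: val_inj; apply/funext => v.
  exact: (congr1 (set_val x : V -> R) (gK v)).
- apply: homotopic_refl => x; apply: val_inj; apply/funext => v.
  exact: (congr1 (set_val x : W -> R) (hK v)).
Qed.

End Homeomorphism.

(** * The multipath complex as a join *)

Section LinearEdges.
Context {T : finType}.
Implicit Types (D : {set T * T}) (G : digraph T).

(** This is [linear_digraph] for a bare edge set, which can be intersected with the edges of a
    module without tracking vertices. *)
Definition linear_edges D : Prop :=
  [/\ {in D &, injective fst}, {in D &, injective snd}
    & forall c, ~~ ((c != [::]) && ucycleb (fun u v => (u, v) \in D) c)].

Lemma linear_edges0 : linear_edges set0.
Proof.
split=> [e f|e f|[|x c]] //; rewrite ?inE //.
by apply/negP => /andP[_ /andP[cyc _]]; have := next_cycle cyc (mem_head x c); rewrite inE.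
Qed.

Lemma linear_edgesS D D' : D \subset D' -> linear_edges D' -> linear_edges D.
Proof.
move=> /subsetP sD [i1 i2 ac]; split=> [e f /sD De /sD|e f /sD De /sD|c].
- exact: i1.
- exact: i2.
apply: contra (ac c) => /andP[-> /andP[cyc uc]]; rewrite /=; apply/andP; split=> //.
by apply: sub_cycle cyc => u v; exact: sD.
Qed.

Lemma mem_multipath_simplices G (A : {set {e : T * T | e \in edges G}}) :
  A \in multipath_simplices G <-> A != set0 /\ linear_edges [set val e | e in A].
Proof.
rewrite inE; split=> [/andP[-> /asboolP[P /multipathP[_ _ linP] <-]]|[-> linA]] //=.
apply/asboolP; exists (Digraph (spanning_subproof A)) => //.
apply/multipathP; split=> //; apply/andP; split=> //.
by apply/subsetP => e /imsetP[f _ ->]; exact: valP.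
Qed.

End LinearEdges.

Section ModuleJoin.
Context {T : finType}.
Variables (G : digraph T) (Ms : seq (digraph T)).
Hypothesis dec : module_decomposition G Ms.

Let N (i : 'I_(size Ms)) : digraph T := tnth (in_tuple Ms) i.

Let N_mem i : N i \in Ms.
Proof. exact: mem_tnth. Qed.

Lemma decomposition_sub i e : e \in edges (N i) -> e \in edges G.
Proof. by case: dec => _ <- _ Ne; apply/bigcup_seqP; exists (N i). Qed.

Lemma decomposition_cover e : e \in edges G -> exists i, e \in edges (N i).
Proof.
case: dec => _ <- _ /bigcup_seqP[M MsM Me].
have /tnthP[i Mi] : M \in in_tuple Ms by [].
by exists i; rewrite /N -Mi.
Qed.

Lemma decomposition_link i e f : e \in edges (N i) -> link G e f -> f \in edges (N i).
Proof.
case: dec => mN _ _; have [/regionP[_ _ _ clN] _] := mN _ (N_mem i).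
exact: clN.
Qed.

Lemma decomposition_index_inj i j e : e \in edges (N i) -> e \in edges (N j) -> i = j.
Proof.
wlog ij : i j / i < j => [H ei ej|].
  by case: (ltngtP i j) => [ij|ji|/val_inj//]; [exact: H | apply/esym; exact: H].
case: dec => _ _ /(pairwiseP (N i))/(_ i j (ltn_ord i) (ltn_ord j) ij) dN.
rewrite /N !(tnth_nth (N i)) => ei ej.
by move/pred0P/(_ e): dN; rewrite /= ei ej.
Qed.

(** Each obstruction to linearity, be it two edges with a common source or target or an oriented
    cycle, lies within one link class, hence in a single module, where it is excluded. *)
Lemma linear_edges_decomposition (D : {set T * T}) : D \subset edges G ->
  (forall i, linear_edges (D :&: edges (N i))) -> linear_edges D.
Proof.
move=> /subsetP sD linD.
have share e f : e \in D -> f \in D -> link G e f ->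
    exists i, (e \in D :&: edges (N i)) /\ (f \in D :&: edges (N i)).
  move=> De Df ef; have [i Ne] := decomposition_cover (sD _ De).
  by exists i; rewrite !inE De Df Ne (decomposition_link Ne ef).
split=> [e f De Df E|e f De Df E|c].
- have [|i [ei fi]] := share e f De Df; first by rewrite /link !sD //= E eqxx.
  by have [i1 _ _] := linD i; exact: i1.
- have [|i [ei fi]] := share e f De Df; first by rewrite /link !sD //= E eqxx orbT.
  by have [_ i2 _] := linD i; exact: i2.
apply/negP => /andP[c0 /andP[cyc uc]]; case: c c0 cyc uc => // x c _ cyc uc.
have oc : oriented_cycle G (x :: c).
  by apply/andP; split=> //; apply/andP; split=> //; apply: sub_cycle cyc => u v /sD.
have xc := mem_head x c.
(* The first edge of the cycle selects the module; the other edges are connected to it by links. *)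
have [i Nx] := decomposition_cover (cycle_edge oc xc).
have [_ _ /(_ (x :: c))/negP[]] := linD i; apply/andP; split=> //.
apply/andP; split=> //; apply: cycle_from_next => // v vc.
rewrite inE (next_cycle cyc vc); case: dec => mN _ _.
have [/regionP[_ _ _ clN] _] := mN _ (N_mem i).
by apply: (link_closed_connect clN Nx); exact: cycle_connect_link.
Qed.

Let E := {i : 'I_(size Ms) & {e : T * T | e \in edges (N i)}}.

Definition module_edge (u : E) : {e : T * T | e \in edges G} :=
  exist _ (val (tagged u)) (decomposition_sub (valP (tagged u))).

(** Surjectivity holds because the modules cover the edges, injectivity because they are
    disjoint. *)
Lemma module_edge_bij : bijective module_edge.
Proof.
have /choice[g gK] : forall e, exists u, module_edge u = e.
  move=> [e Ge]; have [i Ne] := decomposition_cover Ge.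
  by exists (existT _ i (exist _ e Ne)); apply: val_inj.
exists g => //; move=> u.
have : module_edge (g (module_edge u)) = module_edge u by exact: gK.
move: (g _) => w; case: w u => i [e ei] [j [f fj]] /(congr1 val)/= ef; subst f.
have ij := decomposition_index_inj ei fj; subst j.
by congr existT; apply: val_inj.
Qed.

(** This turns the slicewise condition defining the join into one on intersections with the
    modules. *)
Lemma slice_module_edge (A : {set {e : T * T | e \in edges G}}) i :
  [set val e | e in slice i [set u | module_edge u \in A]] =
  [set val e | e in A] :&: edges (N i).
Proof.
apply/setP => e; rewrite inE; apply/imsetP/andP => [[[f Nf]]|[/imsetP[[f Gf] Af ->] Nf]].
  rewrite !inE => Af -> /=; split=> //; apply/imsetP.
  by exists (module_edge (existT _ i (exist _ f Nf))).
exists (exist _ f Nf) => //; rewrite !inE.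
by rewrite (_ : module_edge _ = exist _ f Gf) //; exact: val_inj.
Qed.

Lemma module_join_simplices (A : {set {e : T * T | e \in edges G}}) :
  ([set u | module_edge u \in A] \in
     simplices (simplicial_join (fun i => multipath_complex (N i)))) =
  (A \in simplices (multipath_complex G)).
Proof.
have sliceP i : (slice i [set u | module_edge u \in A] == set0) ||
    (slice i [set u | module_edge u \in A] \in multipath_simplices (N i)) <->
    linear_edges ([set val e | e in A] :&: edges (N i)).
  rewrite -slice_module_edge; have [->|sn0] := eqVneq.
    by rewrite imset0; split=> // _; exact: linear_edges0.
  by split=> [/mem_multipath_simplices[]|lin] //; apply/mem_multipath_simplices.
have A0 : ([set u | module_edge u \in A] != set0) = (A != set0).
  have [g _ gK] := module_edge_bij.
  apply/set0Pn/set0Pn => -[u]; rewrite ?inE => Au; first by exists (module_edge u).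
  by exists (g u); rewrite inE gK.
rewrite -[RHS]/(A \in multipath_simplices G) inE A0.
apply/andP/idP => [[An0 linA]|/mem_multipath_simplices[An0 linA]].
  apply/mem_multipath_simplices; split=> //.
  apply: linear_edges_decomposition.
    by apply/subsetP => e /imsetP[f _ ->]; exact: valP.
  by move=> i; apply/sliceP; exact: (forallP linA).
by split=> //; apply/forallP => i; apply/sliceP; apply: linear_edgesS linA; exact: subsetIl.
Qed.

Lemma multipath_complex_join (R : realType) :
  homotopy_equivalent R (realization R (multipath_complex G))
    (realization R (simplicial_join (fun i => multipath_complex (N i)))).
Proof.
exact: isomorphic_homotopy_equivalent module_edge_bij module_join_simplices.
Qed.

End ModuleJoin.

(** * Computable functions on trees *)

Section TreeSeq.

Lemma tree_eqbP : Equality.axiom tree_eqb.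
Proof.
elim=> [|s1 IH1 s2 IH2] [|t1 t2] /=; try by constructor.
by apply: (iffP andP) => [[/(IH1 t1)-> /(IH2 t2)->]|[<- <-]] //; split; [apply/(IH1 s1)|apply/(IH2 s2)].
Qed.

HB.instance Definition _ := hasDecEq.Build tree tree_eqbP.

Definition hd (t : tree) : tree := if t is Node s _ then s else Leaf.
Definition tl (t : tree) : tree := if t is Node _ s then s else Leaf.

(** Read along its right spine, every tree codes exactly one list, so no well-formedness conditions
    arise. *)
Fixpoint tree_seq (t : tree) : seq tree :=
  if t is Node s u then s :: tree_seq u else [::].

Lemma tree_seqK : cancel tree_seq code_seq.
Proof. by elim=> //= s _ t ->. Qed.

Lemma code_seqK : cancel code_seq tree_seq.
Proof. by elim=> //= t s ->. Qed.

Definition code_bool (b : bool) : tree := if b then Node Leaf Leaf else Leaf.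

End TreeSeq.

Section Computable.

Definition computable (f : tree -> tree) : Prop :=
  exists c, forall x, run c x (f x).

Fixpoint subst_var (v e : expr) : expr :=
  match e with
  | EVar => v
  | ENil => ENil
  | ECons e1 e2 => ECons (subst_var v e1) (subst_var v e2)
  | EHd e1 => EHd (subst_var v e1)
  | ETl e1 => ETl (subst_var v e1)
  | EEq e1 e2 => EEq (subst_var v e1) (subst_var v e2)
  end.

Lemma eval_subst_var v e x : Defs.eval (subst_var v e) x = Defs.eval e (Defs.eval v x).
Proof.
by elim: e => [||e1 IH1 e2 IH2|e IH|e IH|e1 IH1 e2 IH2] //=;
  rewrite ?IH1 ?IH2 ?IH.
Qed.

(** With a single variable, data survive a subcomputation only if stored beside its argument. The
    transformed program works on the left component and preserves the right one. *)
Fixpoint on_head (c : program) : program :=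
  match c with
  | Assign e => Assign (ECons (subst_var (EHd EVar) e) (ETl EVar))
  | Seq c1 c2 => Seq (on_head c1) (on_head c2)
  | While e c => While (subst_var (EHd EVar) e) (on_head c)
  end.

Lemma run_on_head c x y r : run c x y -> run (on_head c) (Node x r) (Node y r).
Proof.
move=> H; elim: H r => {c x y} /=.
- move=> e x r.
  have := run_assign (ECons (subst_var (EHd EVar) e) (ETl EVar)) (Node x r).
  by rewrite /= eval_subst_var.
- by move=> c1 c2 x y z _ IH1 _ IH2 r; apply: run_seq (IH1 r) (IH2 r).
- by move=> e c x ex r; apply: run_while_false; rewrite eval_subst_var.
- move=> e c x y z ex _ IH1 _ IH2 r.
  by apply: run_while_true (IH1 r) (IH2 r); rewrite eval_subst_var.
Qed.

Lemma run_assign_eq e x y : Defs.eval e x = y -> run (Assign e) x y.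
Proof. by move=> <-; exact: run_assign. Qed.

Lemma computable_expr e : computable (Defs.eval e).
Proof. by exists (Assign e) => x; exact: run_assign. Qed.

Lemma computable_comp g f :
  computable g -> computable f -> computable (fun x => g (f x)).
Proof. by move=> [c gc] [d fd]; exists (Seq d c) => x; apply: run_seq (gc _). Qed.

Lemma computable_node f g :
  computable f -> computable g -> computable (fun x => Node (f x) (g x)).
Proof.
move=> [c fc] [d gd].
(* The successive states are (x, x), (f x, x), (x, f x), (g x, f x) and (f x, g x). *)
exists (Seq (Assign (ECons EVar EVar)) (Seq (on_head c)
  (Seq (Assign (ECons (ETl EVar) (EHd EVar))) (Seq (on_head d)
    (Assign (ECons (ETl EVar) (EHd EVar))))))) => x.
apply: run_seq (run_assign _ _) _; apply: run_seq (run_on_head _ (fc _)) _.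
apply: run_seq (run_assign _ _) _; apply: run_seq (run_on_head _ (gd _)) _.
exact: run_assign_eq.
Qed.

Lemma computable_id : computable id.
Proof. exact: (computable_expr EVar). Qed.

Lemma computable_leaf : computable (fun=> Leaf).
Proof. exact: (computable_expr ENil). Qed.

Lemma computable_hd f : computable f -> computable (fun x => hd (f x)).
Proof. exact: (computable_comp (computable_expr (EHd EVar))). Qed.

Lemma computable_tl f : computable f -> computable (fun x => tl (f x)).
Proof. exact: (computable_comp (computable_expr (ETl EVar))). Qed.

Lemma computable_eq f g : computable f -> computable g ->
  computable (fun x => code_bool (f x == g x)).
Proof.
move=> cf cg.
apply: (computable_comp (computable_expr (EEq (EHd EVar) (ETl EVar)))
  (computable_node cf cg)).
Qed.

(* The step function [s] of the fold takes its arguments packed as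
   (parameter, (item, accumulator)). *)
Definition computable3 (s : tree -> tree -> tree -> tree) : Prop :=
  computable (fun t => s (hd t) (hd (tl t)) (tl (tl t))).

Lemma computable_foldl s l a : computable3 s -> computable l -> computable a ->
  computable (fun x => foldl (fun z y => s x y z) (a x) (tree_seq (l x))).
Proof.
move=> [c sc] cl ca.
have [d dE] := computable_node cl (computable_node ca computable_id).
(* The loop state is (remaining list, (accumulator, parameter)). *)
pose acc := EHd (ETl EVar); pose par := ETl (ETl EVar).
(* The first assignment forms ((parameter, (item, accumulator)), (rest, parameter)). Then [c] turns
   the head into the new accumulator, and the last assignment restores the shape of the state. *)
pose body := Seq
  (Assign (ECons (ECons par (ECons (EHd (EHd EVar)) acc)) (ECons (ETl (EHd EVar)) par)))
  (Seq (on_head c)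
       (Assign (ECons (EHd (ETl EVar)) (ECons (EHd EVar) (ETl (ETl EVar)))))).
exists (Seq d (Seq (While (EHd EVar) body) (Assign acc))) => x.
apply: run_seq (dE x) _.
set z := a x; set t := l x; clearbody z t.
suff : run (While (EHd EVar) body) (Node t (Node z x))
           (Node Leaf (Node (foldl (fun z y => s x y z) z (tree_seq t)) x)).
  by move=> H; apply: run_seq H _; exact: run_assign_eq.
elim: t z => [|y _ t IHt] z; first exact: run_while_false.
apply: run_while_true (IHt (s x y z)) => //.
apply: run_seq (run_assign _ _) _; apply: run_seq (run_on_head _ (sc _)) _.
exact: run_assign_eq.
Qed.

Lemma computable_ext f g : f =1 g -> computable f -> computable g.
Proof. by move=> fg [c fc]; exists c => x; rewrite -fg. Qed.

Definition computable2 (s : tree -> tree -> tree) : Prop :=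
  computable (fun t => s (hd t) (tl t)).

Lemma computable2_app s f g : computable2 s -> computable f -> computable g ->
  computable (fun x => s (f x) (g x)).
Proof. by move=> cs cf cg; exact: (computable_comp cs (computable_node cf cg)). Qed.

(** The loop consumes a list from the front; a right fold is obtained as a left fold over the
    reversed list. *)
Lemma computable_rev l : computable l ->
  computable (fun x => code_seq (rev (tree_seq (l x)))).
Proof.
move=> cl.
have cs : computable3 (fun _ y z => Node y z).
  apply: computable_node; first exact/computable_hd/computable_tl/computable_id.
  exact/computable_tl/computable_tl/computable_id.
apply: computable_ext (computable_foldl cs cl computable_leaf) => x.
rewrite /rev -[Leaf]/(code_seq [::]); set a := [::]; clearbody a.
by elim: (tree_seq _) a => //= y s IHs a; rewrite -IHs.
Qed.

Lemma computable_foldr s l a : computable3 s -> computable l -> computable a ->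
  computable (fun x => foldr (fun y z => s x y z) (a x) (tree_seq (l x))).
Proof.
move=> cs cl ca.
apply: computable_ext (computable_foldl cs (computable_rev cl) ca) => x.
by rewrite code_seqK foldl_rev.
Qed.

(** The code of a boolean is a list of length one or zero, so a fold over it replaces the default
    [g x] by [f x] exactly in the true case. *)
Lemma computable_if (b : tree -> bool) f g :
  computable (fun x => code_bool (b x)) -> computable f -> computable g ->
  computable (fun x => if b x then f x else g x).
Proof.
move=> cb cf cg; have cs : computable3 (fun x _ _ => f x).
  exact: (computable_comp cf (computable_hd computable_id)).
by apply: computable_ext (computable_foldl cs cb cg) => x; case: (b x).
Qed.

Lemma computable_or (a b : tree -> bool) :
  computable (fun x => code_bool (a x)) -> computable (fun x => code_bool (b x)) ->
  computable (fun x => code_bool (a x || b x)).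
Proof.
move=> ca cb; apply: computable_ext (computable_if ca ca cb) => x.
by case: (a x).
Qed.

Lemma computable_and (a b : tree -> bool) :
  computable (fun x => code_bool (a x)) -> computable (fun x => code_bool (b x)) ->
  computable (fun x => code_bool (a x && b x)).
Proof.
move=> ca cb; apply: computable_ext (computable_if ca cb computable_leaf) => x.
by case: (a x).
Qed.

(** * Computable operations on lists *)

Let arg1 := computable_hd computable_id.
Let arg2 := computable_hd (computable_tl computable_id).
Let arg3 := computable_tl (computable_tl computable_id).

Definition computable_pred2 (p : tree -> tree -> bool) : Prop :=
  computable2 (fun x y => code_bool (p x y)).

Lemma computable_pred2_app p f g :
  computable_pred2 p -> computable f -> computable g ->
  computable (fun x => code_bool (p (f x) (g x))).
Proof. exact: computable2_app. Qed.

Lemma computable_has p l : computable_pred2 p -> computable l ->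
  computable (fun x => code_bool (has (p x) (tree_seq (l x)))).
Proof.
move=> cp cl.
have cs : computable3 (fun x y z => if p x y then Node Leaf Leaf else z).
  apply: computable_if; [exact: computable_pred2_app| |exact: arg3].
  exact: (computable_node computable_leaf computable_leaf).
apply: computable_ext (computable_foldr cs cl computable_leaf) => x.
by elim: (tree_seq _) => //= y s ->; case: (p x y).
Qed.

Lemma computable_filter p l : computable_pred2 p -> computable l ->
  computable (fun x => code_seq [seq y <- tree_seq (l x) | p x y]).
Proof.
move=> cp cl.
have cs : computable3 (fun x y z => if p x y then Node y z else z).
  apply: computable_if; [exact: computable_pred2_app| |exact: arg3].
  exact: (computable_node arg2 arg3).
apply: computable_ext (computable_foldr cs cl computable_leaf) => x.
by elim: (tree_seq _) => //= y s ->; case: (p x y).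
Qed.

Lemma computable_map f l : computable2 f -> computable l ->
  computable (fun x => code_seq (map (f x) (tree_seq (l x)))).
Proof.
move=> cf cl.
have cs : computable3 (fun x y z => Node (f x y) z).
  exact: (computable_node (computable2_app cf arg1 arg2) arg3).
apply: computable_ext (computable_foldr cs cl computable_leaf) => x.
by elim: (tree_seq _) => //= y s ->.
Qed.

Lemma computable_undup l : computable l ->
  computable (fun x => code_seq (undup (tree_seq (l x)))).
Proof.
move=> cl.
have cs : computable3 (fun _ y z => if has (pred1 y) (tree_seq z) then z else Node y z).
  rewrite /computable3; apply: (computable_if (b := fun t => has (pred1 (hd (tl t)))
    (tree_seq (tl (tl t)))) _ arg3 (computable_node arg2 arg3)).
  have ce : computable_pred2 (fun u v => v == hd (tl u)).
    apply: computable_eq; first exact: (computable_tl computable_id).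
    exact/computable_hd/computable_tl/computable_hd/computable_id.
  exact: (computable_has ce arg3).
apply: computable_ext (computable_foldr cs cl computable_leaf) => x.
elim: (tree_seq _) => //= y s ->; rewrite code_seqK has_pred1 mem_undup.
by case: (y \in s).
Qed.

(** This is a fold that ignores the items, the length of a list serving as the counter. *)
Lemma computable_iter f n a : computable2 f -> computable n -> computable a ->
  computable (fun x => iter (size (tree_seq (n x))) (f x) (a x)).
Proof.
move=> cf cn ca.
have cs : computable3 (fun x _ z => f x z) by exact: (computable2_app cf arg1 arg3).
apply: computable_ext (computable_foldr cs cn ca) => x.
by elim: (tree_seq _) => //= y s ->.
Qed.

End Computable.

(** * The algorithm *)

Section Saturation.

Lemma subset_seq1 (X : eqType) (E : seq X) e : e \in E -> {subset [:: e] <= E}.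
Proof. by move=> Ee x; rewrite inE => /eqP->. Qed.

(** A round replaces [S'] by its neighbours in [E], so nothing is lost when [r] is reflexive on [E].
    As many rounds as [E] has entries suffice, since a duplicate-free chain is no longer than
    [E]. *)
Definition saturate (X : Type) (r : X -> X -> bool) (E S : seq X) : seq X :=
  iter (size E) (fun S' => [seq x <- E | has (r^~ x) S']) S.

Lemma saturate_map (X Y : eqType) (f : X -> Y) (r : X -> X -> bool) (r' : Y -> Y -> bool)
    (E S : seq X) :
  {in E &, forall x y, r' (f x) (f y) = r x y} -> {subset S <= E} ->
  saturate r' (map f E) (map f S) = map f (saturate r E S).
Proof.
move=> rr'; rewrite /saturate size_map.
elim: (size E) S => // n IHn S SE; rewrite !iterSr -IHn; last first.
  by move=> x; rewrite mem_filter => /andP[].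
congr (iter _ _ _); rewrite filter_map; congr map; apply: eq_in_filter => x Ex /=.
by rewrite has_map; apply: eq_in_has => y /SE Ey /=; exact: rr'.
Qed.

Lemma saturate_sub (X : eqType) (r : rel X) (E S : seq X) :
  {subset S <= E} -> {subset saturate r E S <= E}.
Proof.
rewrite /saturate; elim: (size E) => //= n IHn SE x.
by rewrite mem_filter => /andP[].
Qed.

(** The result keeps the order of [E], so its members determine it as a list. For empty [E] no round
    is run and [S] would be returned unchanged. *)
Lemma saturate_filter (X : eqType) (r : rel X) (E S : seq X) : 0 < size E ->
  saturate r E S = [seq x <- E | x \in saturate r E S].
Proof.
rewrite /saturate; case: (size E) => // n _ /=.
by apply: eq_in_filter => x Ex; rewrite mem_filter Ex andbT.
Qed.

Lemma mem_saturate (X : finType) (r : rel X) (E : seq X) e x :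
  {in E, reflexive r} -> e \in E ->
  (x \in saturate r E [:: e]) =
  connect (fun u v => [&& u \in E, v \in E & r u v]) e x.
Proof.
move=> rr Ee; set r' := (X in connect X).
pose F S := [seq x <- E | has (r^~ x) S].
apply/idP/idP.
  suff H n : x \in iter n F [:: e] -> connect r' e x /\ x \in E.
    by move=> /H[].
  elim: n x => [|n IHn] x /=; first by rewrite inE => /eqP ->; rewrite connect0.
  rewrite mem_filter => /andP[/hasP[y /IHn[ey Ey] yx] Ex]; split=> //.
  by apply: connect_trans ey (connect1 _); rewrite /r' Ey Ex.
(* Reflexivity lets chains shorter than the number of rounds be padded at their start. *)
have reach n p : path r' e p -> size p <= n -> last e p \in iter n F [:: e].
  elim: n p => [|n IHn] p ep; first by case: p ep => //; rewrite mem_head.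
  case/lastP: p ep => [_ _|p y].
    rewrite /= mem_filter Ee andbT; apply/hasP; exists e; last exact: rr.
    exact: (IHn [::]).
  rewrite rcons_path size_rcons last_rcons => /andP[ep /and3P[_ Ey yr]] pn.
  rewrite /= mem_filter Ey andbT; apply/hasP; exists (last e p) => //.
  exact: IHn.
move=> /connectP[p ep ->]; case: (shortenP ep) => q eq uq _.
apply: reach => //; apply: ltnW; rewrite -[X in X <= _]/(size (e :: q)).
apply: uniq_leq_size => //= y; rewrite inE => /predU1P[->//|].
elim: q e eq {ep uq Ee} => //= z q IHq e /andP[/and3P[_ Ez _] zq].
by rewrite inE => /predU1P[->//|]; exact: IHq zq.
Qed.

End Saturation.

(** * The algorithm for edges and vertices of arbitrary types *)

Section Algorithm.
Variables (X Y : eqType) (src tgt : X -> Y).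
Implicit Types (E : seq X) (V : seq Y) (e f : X).

(** Equality is added because saturation needs a reflexive relation. *)
Definition succ_or_eq e f : bool := (e == f) || (tgt e == src f).

Definition cyclic E e : bool :=
  has (fun f => tgt f == src e) (saturate succ_or_eq E [:: e]).

Definition linked E e f : bool :=
  (src e == src f) || ((tgt e == tgt f) ||
    ((tgt e == src f) && cyclic E e || (tgt f == src e) && cyclic E f)).

Definition module_edges E e : seq X := saturate (linked E) E [:: e].

Definition module_verts V (D : seq X) : seq Y :=
  [seq v <- V | has (fun f => (src f == v) || (tgt f == v)) D].

End Algorithm.

(** * Invariance of the algorithm under injective renaming *)

Section AlgorithmMap.
Variables (X Y X' Y' : eqType) (src tgt : X -> Y) (src' tgt' : X' -> Y').
Variables (phi : X -> X') (psi : Y -> Y') (E : seq X) (V : seq Y).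
Hypothesis phi_inj : {in E &, injective phi}.
Hypothesis psi_inj : {in V &, injective psi}.
Hypotheses (src_phi : forall e, src' (phi e) = psi (src e))
           (tgt_phi : forall e, tgt' (phi e) = psi (tgt e)).
Hypothesis srcV : {in E, forall e, src e \in V}.
Hypothesis tgtV : {in E, forall e, tgt e \in V}.

Let psi_eq : {in V &, forall u v, (psi u == psi v) = (u == v)}.
Proof. exact: inj_in_eq. Qed.

Lemma cyclic_map : {in E, forall e, cyclic src' tgt' (map phi E) (phi e) = cyclic src tgt E e}.
Proof.
move=> e Ee; rewrite /cyclic.
rewrite (@saturate_map _ _ phi (succ_or_eq src tgt) _ E [:: e]); last exact: subset_seq1.
  rewrite has_map; apply: eq_in_has => f /(saturate_sub (subset_seq1 Ee)) Ef /=.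
  by rewrite src_phi tgt_phi psi_eq ?srcV ?tgtV.
move=> x y Ex Ey; rewrite /succ_or_eq (inj_in_eq phi_inj) //.
by rewrite src_phi tgt_phi psi_eq ?srcV ?tgtV.
Qed.

Lemma module_edges_map : {in E, forall e,
  module_edges src' tgt' (map phi E) (phi e) = map phi (module_edges src tgt E e)}.
Proof.
move=> e Ee; apply: (@saturate_map _ _ phi _ _ E [:: e]); last exact: subset_seq1.
move=> x y Ex Ey; rewrite /linked !cyclic_map //.
by rewrite !src_phi !tgt_phi !psi_eq ?srcV ?tgtV.
Qed.

Lemma module_verts_map D : {subset D <= E} ->
  module_verts src' tgt' (map psi V) (map phi D) = map psi (module_verts src tgt V D).
Proof.
move=> DE; rewrite /module_verts filter_map; congr map.
apply: eq_in_filter => v Vv /=; rewrite has_map; apply: eq_in_has => f /DE Ef /=.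
by rewrite src_phi tgt_phi !psi_eq ?srcV ?tgtV.
Qed.

End AlgorithmMap.

(** * Correctness of the algorithm on a digraph *)

Section AlgorithmCorrect.
Context {T : finType}.
Variable G : digraph T.
Let EG := enum (edges G).

Lemma cyclicE : {in edges G, forall e,
  cyclic fst snd EG e = connect (edge_rel G) e.2 e.1}.
Proof.
move=> e Ge; have Ee : e \in EG by rewrite mem_enum.
apply/hasP/idP => [[f]|/connectP[p]].
  rewrite mem_saturate //; last by move=> x _; rewrite /succ_or_eq eqxx.
  move=> ef /eqP <-; case/connectP: ef => p; elim: p e {Ge Ee} => [|g p IHp] e /=.
    by move=> _ ->.
  case/andP=> /and3P[_ Eg /orP[/eqP->|/eqP eg]] gp fE; first exact: IHp.
  apply: connect_trans (IHp _ gp fE); apply: connect1.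
  by rewrite /edge_rel eg -surjective_pairing -mem_enum.
(* The endpoint [e.1] is generalised, so that the induction finds a chain of edges ending at any
   vertex reachable from [e.2]. *)
elim/last_ind: p (e.1) => [|p v IHp] w /=.
  by move=> _ ->; exists e; rewrite // mem_saturate // => x _; rewrite /succ_or_eq eqxx.
rewrite rcons_path last_rcons => /andP[ep pv ->].
have [f sf /eqP fE] := IHp _ ep erefl.
exists (last e.2 p, v) => //=; move: (sf); rewrite !mem_saturate //;
  try by move=> x _; rewrite /succ_or_eq eqxx.
move=> ef; apply: connect_trans ef (connect1 _).
rewrite !mem_enum /succ_or_eq fE eqxx orbT andbT -[X in _ && X]/(edge_rel G _ _) pv andbT.
by move/(saturate_sub (subset_seq1 Ee)): sf; rewrite mem_enum.
Qed.

Lemma linkedE : {in edges G &, forall e f, linked fst snd EG e f = link G e f}.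
Proof.
by move=> e f Ge Gf; rewrite /linked /link /follows Ge Gf !cyclicE.
Qed.

(** Codes depend on the order of lists, so equality of lists is required. Both sides are filters of
    the enumeration of all edges by the same class. *)
Lemma module_edgesE e : e \in edges G ->
  module_edges fst snd EG e = enum (edges (link_module G e)).
Proof.
move=> Ge; have Ee : e \in EG by rewrite mem_enum.
have mE f : (f \in module_edges fst snd EG e) = (f \in link_class G e).
  rewrite mem_saturate //; last by move=> x _; rewrite /linked eqxx.
  rewrite inE; transitivity (connect (link G) e f).
    apply: eq_connect => u v /=; rewrite !mem_enum.
    apply/and3P/idP => [[Gu Gv]|uv]; first by rewrite linkedE.
    by have /and3P[Gu Gv _] := uv; split=> //; rewrite linkedE.
  by apply/idP/andP => [ef|[]//]; rewrite (connect_link_edge Ge ef).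
have -> : enum (edges (link_module G e)) = [seq f <- EG | f \in link_class G e].
  rewrite /enum_mem -filter_predI; apply: eq_filter => f /=.
  by rewrite !inE andbAC andbb.
rewrite {1}/module_edges saturate_filter; last by case: EG Ee.
exact: eq_filter.
Qed.

End AlgorithmCorrect.

(** * The algorithm on codes and its computability *)

Section TreeAlgorithm.
Implicit Types (t : tree).

(** The code of an edge is the node of the codes of its ends, so [hd] and [tl] act as source and
    target. *)
Definition tree_module (V E : seq tree) (e : tree) : tree :=
  let D := module_edges hd tl E e in
  Node (code_seq (module_verts hd tl V D)) (code_seq D).

Definition tree_modules t : tree :=
  let V := tree_seq (hd t) in let E := tree_seq (tl t) in
  code_seq (undup [seq tree_module V E e | e <- E]).

Ltac computable_tac := repeat first
  [ exact: computable_id | exact: computable_leaf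
  | match goal with H : computable _ |- _ => apply: (computable_comp H) end
  | apply: computable_hd | apply: computable_tl | apply: computable_node
  | apply: computable_eq | apply: computable_or | apply: computable_and ].

Definition computable_pred3 (p : tree -> tree -> tree -> bool) : Prop :=
  computable3 (fun x y z => code_bool (p x y z)).

Lemma computable_pred3_app p f g h : computable_pred3 p ->
  computable f -> computable g -> computable h ->
  computable (fun x => code_bool (p (f x) (g x) (h x))).
Proof.
move=> cp cf cg ch.
exact: (computable_comp cp (computable_node cf (computable_node cg ch))).
Qed.

Lemma computable_saturate p l s : computable_pred3 p -> computable l -> computable s ->
  computable (fun x => code_seq (saturate (p x) (tree_seq (l x)) (tree_seq (s x)))).
Proof.
move=> cp cl cs.
(* The parameter and the current list are packed into one tree, since a filter predicate has a
   single parameter. *)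
pose q t y := has (fun w => p (hd t) w y) (tree_seq (tl t)).
have cq : computable_pred2 q.
  apply: (computable_has (p := fun u w => p (hd (hd u)) w (tl u))
                         (l := fun u => tl (hd u))); last by computable_tac.
  by apply: (computable_pred3_app cp); computable_tac.
pose step x z := code_seq [seq y <- tree_seq (l x) | q (Node x z) y].
have cstep : computable2 step.
  have cl' : computable (fun t => l (hd t)) by computable_tac.
  have cq' : computable_pred2 (fun t y => q (Node (hd t) (tl t)) y).
    have cn : computable (fun u => Node (hd (hd u)) (tl (hd u))) by computable_tac.
    exact: (computable_pred2_app cq cn (computable_tl computable_id)).
  exact: (computable_filter cq' cl').
apply: computable_ext (computable_iter cstep cl cs) => x.
rewrite /saturate; elim: (size _) => [|n IHn] /=; first by rewrite tree_seqK.
by rewrite IHn /step /q /= code_seqK.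
Qed.

Lemma computable_cyclic l e : computable l -> computable e ->
  computable (fun x => code_bool (cyclic hd tl (tree_seq (l x)) (e x))).
Proof.
move=> cl ce.
have csucc : computable_pred3 (fun=> succ_or_eq hd tl) by computable_tac.
have cs := computable_saturate csucc cl (computable_node ce computable_leaf).
apply: (computable_ext _ (computable_has (p := fun x f => tl f == hd (e x)) _ cs)).
  by move=> x; rewrite code_seqK.
by computable_tac.
Qed.

Lemma computable_module_edges l e : computable l -> computable e ->
  computable (fun x => code_seq (module_edges hd tl (tree_seq (l x)) (e x))).
Proof.
move=> cl ce.
have clinked : computable_pred3 (fun x => linked hd tl (tree_seq (l x))).
  rewrite /computable_pred3 /computable3 /linked.
  do ![apply: computable_or|apply: computable_and|apply: (computable_cyclic (l := fun t => l (hd t)))];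
    by computable_tac.
exact: (computable_saturate clinked cl (computable_node ce computable_leaf)).
Qed.

Lemma computable_module_verts v d : computable v -> computable d ->
  computable (fun x => code_seq (module_verts hd tl (tree_seq (v x)) (tree_seq (d x)))).
Proof.
move=> cv cd.
apply: (computable_filter (p := fun x y =>
  has (fun f => (hd f == y) || (tl f == y)) (tree_seq (d x)))) => //.
apply: (computable_has (p := fun u f => (hd f == tl u) || (tl f == tl u))
                       (l := fun u => d (hd u))); by computable_tac.
Qed.

Lemma computable_tree_modules : computable tree_modules.
Proof.
have cE : computable tl by computable_tac.
have cM : computable2 (fun t e => tree_module (tree_seq (hd t)) (tree_seq (tl t)) e).
  have cD : computable (fun u => code_seq (module_edges hd tl (tree_seq (tl (hd u))) (tl u))).
    by apply: (computable_module_edges (l := fun u => tl (hd u))); computable_tac.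
  apply: computable_node => //.
  apply: computable_ext (computable_module_verts (v := fun u => hd (hd u)) _ cD).
    by move=> u; rewrite code_seqK.
  by computable_tac.
apply: computable_ext (computable_undup (computable_map cM cE)) => t.
by rewrite code_seqK.
Qed.

End TreeAlgorithm.

Lemma undup_map_in (X Y : eqType) (f : X -> Y) (s : seq X) :
  {in s &, injective f} -> undup (map f s) = map f (undup s).
Proof.
elim: s => //= x s IHs f_inj; rewrite IHs; last first.
  by move=> y z ys zs; apply: f_inj; rewrite inE ?ys ?zs orbT.
rewrite (_ : (f x \in map f s) = (x \in s)); first by case: (x \in s).
apply/mapP/idP => [[y ys xy]|xs]; last by exists x.
by rewrite (f_inj _ _ _ _ xy) // inE ?eqxx ?ys ?orbT.
Qed.

(** * Agreement of the computation on codes with the link modules *)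

Section Codes.
Context {T : finType}.
Variable G : digraph T.

Lemma code_nat_inj : injective code_nat.
Proof. by elim=> [|m IHm] [|n] //= [/IHm->]. Qed.

Lemma code_seq_inj : injective code_seq.
Proof. exact: can_inj code_seqK. Qed.

Lemma code_vertex_inj : {in verts G &, injective (code_vertex G)}.
Proof.
move=> u v Gu Gv /code_nat_inj uv.
by rewrite -[u](nth_index u (s := enum (verts G))) ?mem_enum // uv nth_index ?mem_enum.
Qed.

Lemma code_edge_inj : {in edges G &, injective (code_edge G)}.
Proof.
move=> [a b] [c d] /edgeP[/= Ga Gb _] /edgeP[/= Gc Gd _] [ac bd].
by rewrite (code_vertex_inj Ga Gc ac) (code_vertex_inj Gb Gd bd).
Qed.

(** The code of [f] occurs among the edge codes of its own module, hence among those of the module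
    of [e]. So [f] lies in the class of [e]. *)
Lemma code_link_module_inj : {in edges G &, forall e f,
  code_subdigraph G (link_module G e) = code_subdigraph G (link_module G f) ->
  link_module G e = link_module G f}.
Proof.
move=> e f Ge Gf [_ /code_seq_inj] E; apply: link_module_edge_eq.
have : code_edge G f \in map (code_edge G) (enum (edges (link_module G e))).
  by rewrite E; apply: map_f; rewrite mem_enum; exact: link_module_mem.
case/mapP => g; rewrite mem_enum => Mg.
by move/code_edge_inj-> => //; case/setIdP: Mg.
Qed.

Lemma tree_modulesE :
  tree_modules (code_subdigraph G G) =
  code_seq [seq code_subdigraph G M | M <- link_modules G].
Proof.
rewrite /tree_modules /= !code_seqK; congr code_seq.
(* Coding is injective on modules, so removing duplicate codes amounts to removing duplicate
   modules. *)
rewrite -undup_map_in; last first.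
  move=> _ _ /mapP[e + ->] /mapP[f + ->]; rewrite !mem_enum.
  exact: code_link_module_inj.
congr undup; rewrite -!map_comp; apply/eq_in_map => e; rewrite mem_enum => Ge /=.
have phi_inj : {in enum (edges G) &, injective (code_edge G)}.
  by move=> f g; rewrite !mem_enum; exact: code_edge_inj.
have psi_inj : {in enum (verts G) &, injective (code_vertex G)}.
  by move=> f g; rewrite !mem_enum; exact: code_vertex_inj.
have srcV : {in enum (edges G), forall f, f.1 \in enum (verts G)}.
  by move=> f; rewrite !mem_enum => /edgeP[].
have tgtV : {in enum (edges G), forall f, f.2 \in enum (verts G)}.
  by move=> f; rewrite !mem_enum => /edgeP[].
rewrite /tree_module /code_subdigraph.
rewrite (module_edges_map (src := fst) (tgt := snd) phi_inj psi_inj) //; last by rewrite mem_enum.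
rewrite module_edgesE //.
rewrite (module_verts_map (src := fst) (tgt := snd) (E := enum (edges G)) psi_inj) //; last first.
  by move=> f; rewrite !mem_enum => /setIdP[].
congr (Node (code_seq (map _ _)) _).
have /andP[/subsetP sV _] := link_module_sub G e.
have -> : enum (verts (link_module G e)) =
    [seq v <- enum (verts G) | v \in verts (link_module G e)].
  rewrite /enum_mem -filter_predI; apply: eq_filter => v /=.
  by apply/idP/andP => [Mv|[]//]; split=> //; exact: sV.
apply: eq_filter => v; apply/hasP/endpointsP => [[f]|[f Mf vf]].
  by rewrite mem_enum => Mf /orP[]/eqP <-; exists f; auto.
by exists f; [rewrite mem_enum | case: vf => ->; rewrite eqxx ?orbT].
Qed.

End Codes.

Theorem theorem4p11 (R : realType) :
  (forall (T : finType) (G : digraph T),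
    exists Ms : seq (digraph T),
      [/\ module_decomposition G Ms,
          (forall Ns : seq (digraph T), module_decomposition G Ns -> perm_eq Ms Ns)
        & homotopy_equivalent R
            (realization R (multipath_complex G))
            (realization R
              (simplicial_join (fun i : 'I_(size Ms) =>
                 multipath_complex (tnth (in_tuple Ms) i))))])
  /\
  (exists c : program, forall (T : finType) (G : digraph T),
    exists2 Ms : seq (digraph T), module_decomposition G Ms
      & run c (code_subdigraph G G)
              (code_seq [seq code_subdigraph G M | M <- Ms])).
Proof.
split=> [T G|].
  have dec := link_modules_decomposition G.
  exists (link_modules G); split=> //; first exact: decomposition_perm.
  exact: multipath_complex_join dec R.
(* The function [tree_modules] sees only trees, so one program serves all types and digraphs. *)
have [c cE] := computable_tree_modules; exists c => T G.
exists (link_modules G); first exact: link_modules_decomposition.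
by rewrite -tree_modulesE; exact: cE.
Qed.
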